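(* Let $\kappa$ be a cardinal, let $\alpha_r=\omega_1$ for some $r\in\kappa$, and let $\alpha_i$ be an ordinal with $2\leq\alpha_i<\omega_1$ for all $i\in\kappa\setminus\{r\}$. Then $P^{top}(\alpha_i)_{i\in\kappa}=\max\{\omega_1,\kappa^+\}$.
   Context: Ordinals carry the order topology, subsets the subspace topology. $P^{top}(\alpha_i)_{i\in\kappa}$ is the least ordinal $\beta$ such that for every $c:\beta\to\kappa$ there exist $i\in\kappa$ and $X\subseteq c^{-1}(\{i\})$ homeomorphic to $\alpha_i$ ($\infty$ if none exists). $\kappa^+$ is the cardinal successor of $\kappa$. *)

(* Defs.v *)
From HB Require Import structures.
From mathcomp Require Import all_boot all_order generic_quotient.
From mathcomp Require Import all_classical topology.
From mathcomp Require Import wochoice.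

Set Implicit Arguments.
Unset Strict Implicit.
Unset Printing Implicit Defensive.

Import Order.TTheory.
Local Open Scope classical_set_scope.
Local Open Scope quotient_scope.
Local Open Scope card_scope.
Local Open Scope order_scope.

(* Ordinals are the order types of well-ordered sets. The carrier of a woset
   lives in a universe of its own, strictly below that of the type Ord, so
   that Ord can itself carry MathComp structures. *)
Record woset := Woset {
  wcar : Type;
  wle : rel wcar;
  wle_wo : well_order wle }.

HB.instance Definition _ := gen_eqMixin woset.
HB.instance Definition _ := gen_choiceMixin woset.

Section WosetTheory.
Variable a : woset.
Implicit Types x y z : wcar a.

Definition wlt x y := ~~ wle y x.

Lemma wle_min (P : wcar a -> Prop) x0 : P x0 ->
  exists2 x, P x & forall y, P y -> wle x y.
Proof.
move=> Px0.
have [|x [[Px minx] _]] := @wle_wo a [pred x | `[< P x >]].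
  by exists x0; apply/asboolP.
exists x; first exact/asboolP.
by move=> y Py; apply: minx; apply/asboolP.
Qed.

Lemma wle_total x y : wle x y || wle y x.
Proof.
have [z zP minz] := @wle_min (fun z => z = x \/ z = y) x (or_introl erefl).
case: zP => E; subst z; first by rewrite (minz y) //; right.
by rewrite orbC (minz x) //; left.
Qed.

Lemma wle_refl x : wle x x.
Proof. by have := wle_total x x; rewrite orbb. Qed.

Lemma wle_anti x y : wle x y -> wle y x -> x = y.
Proof.
move=> xy yx.
have [|z [_ Uz]] := @wle_wo a [pred z | `[< z = x \/ z = y >]].
  by exists x; apply/asboolP; left.
have zx : z = x.
  apply: Uz; split; first by apply/asboolP; left.
  by move=> t /asboolP[] -> //; rewrite wle_refl.
rewrite -zx; apply: Uz; split; first by apply/asboolP; right.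
by move=> t /asboolP[] -> //; rewrite wle_refl.
Qed.

Lemma wle_trans x y z : wle x y -> wle y z -> wle x z.
Proof.
move=> xy yz.
have [t tP mint] := @wle_min (fun t => [\/ t = x, t = y | t = z]) x
  ltac:(by constructor 1).
have [tx ty tz] : [/\ wle t x, wle t y & wle t z].
  by split; apply: mint; [constructor 1|constructor 2|constructor 3].
case: tP => E; subst t => //.
  by rewrite (wle_anti xy tx).
by rewrite -(wle_anti yz ty).
Qed.

Lemma wltW x y : wlt x y -> wle x y.
Proof. by move=> /negPf h; have := wle_total x y; rewrite h orbF. Qed.

Lemma wlt_wf : well_founded wlt.
Proof.
move=> x; apply: contrapT => nx.
have [y ny miny] := @wle_min (fun x => ~ Acc wlt x) x nx.
apply: ny; constructor => z zy; apply: contrapT => nz.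
by move: zy; rewrite /wlt (miny z nz).
Qed.

Lemma well_order_sub (S : wcar a -> Prop) :
  well_order (fun x y : {x | S x} => wle (sval x) (sval y)).
Proof.
apply: antisymmetric_well_order.
  move=> x y /andP[xy yx]; apply: eq_sig_hprop; first by move=> ? ? ?.
  exact: wle_anti.
move=> A [x Ax].
have [y [x' Ax' <-] miny] :=
  @wle_min (fun y => exists2 x, x \in A & sval x = y) (sval x)
    ltac:(by exists x).
by exists x'; split => // z Az; apply: miny; exists z.
Qed.

End WosetTheory.

(* Isomorphisms onto an initial segment. *)
Definition winitial (a b : woset) (f : wcar a -> wcar b) : Prop :=
  {mono f : x y / wle x y} /\ forall x y, wle y (f x) -> exists x', f x' = y.

Definition wiso (a b : woset) : Prop :=
  exists f : wcar a -> wcar b, {mono f : x y / wle x y} /\ bijective f.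

Definition winit (a b : woset) : Prop :=
  exists f : wcar a -> wcar b, winitial f.

Lemma wmono_inj (a b : woset) (f : wcar a -> wcar b) :
  {mono f : x y / wle x y} -> injective f.
Proof.
by move=> fm x y fxy; apply: wle_anti; rewrite -fm fxy wle_refl.
Qed.

Lemma winitial_uniq (a b : woset) (f g : wcar a -> wcar b) :
  winitial f -> winitial g -> f = g.
Proof.
have H (f1 g1 : wcar a -> wcar b) x : winitial f1 -> winitial g1 ->
    (forall y, wlt y x -> f1 y = g1 y) -> wle (f1 x) (g1 x).
  move=> [fm fi] [gm gi] IH; apply: contrapT => /negP nfg.
  have [x' fx'] := fi _ _ (wltW nfg).
  have x'x : wlt x' x.
    by rewrite /wlt -fm fx'.
  have := IH _ x'x; rewrite fx' => /(wmono_inj gm) E.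
  by move: x'x; rewrite -E /wlt wle_refl.
move=> fi gi; apply/funext => x.
elim/(well_founded_ind (@wlt_wf a)): x => x IH.
by apply: wle_anti; apply: H => // y /IH ->.
Qed.

Lemma winitial_comp (a b c : woset) (f : wcar a -> wcar b) (g : wcar b -> wcar c) :
  winitial f -> winitial g -> winitial (g \o f).
Proof.
move=> [fm fi] [gm gi]; split=> [x y|x y /= yx]; first by rewrite /= gm fm.
have [z zy] := gi _ _ yx.
have [|x' x'z] := fi x z; first by rewrite -gm zy.
by exists x'; rewrite /= x'z.
Qed.

Lemma winitial_id (a : woset) : winitial (@id (wcar a)).
Proof. by split=> // x y _; exists y. Qed.

Lemma winit_refl a : winit a a.
Proof. by exists id; apply: winitial_id. Qed.

Lemma winit_trans b a c : winit a b -> winit b c -> winit a c.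
Proof. by move=> [f fi] [g gi]; exists (g \o f); apply: winitial_comp. Qed.

Lemma wiso_init a b : wiso a b -> winit a b.
Proof.
by move=> [f [fm [g fK gK]]]; exists f; split=> // x y _; exists (g y).
Qed.

Lemma wiso_sym a b : wiso a b -> wiso b a.
Proof.
move=> [f [fm [g fK gK]]]; exists g; split; last by exists f.
by move=> x y; rewrite -fm !gK.
Qed.

Lemma winit_anti a b : winit a b -> winit b a -> wiso a b.
Proof.
move=> [f fi] [g gi].
have gf := winitial_uniq (winitial_comp fi gi) (@winitial_id a).
have fg := winitial_uniq (winitial_comp gi fi) (@winitial_id b).
exists f; split; first by case: fi.
by exists g => x; [move: (f_equal (@^~ x) gf)|move: (f_equal (@^~ x) fg)].
Qed.

Lemma wisoP a b : wiso a b <-> winit a b /\ winit b a.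
Proof.
split=> [ab|[]]; last exact: winit_anti.
by split; apply: wiso_init => //; apply: wiso_sym.
Qed.

Lemma winit_total a b : winit a b \/ winit b a.
Proof.
pose good (x : wcar a) (h : forall y, wlt y x -> option (wcar b)) z :=
  forall y yx, h y yx <> Some z.
pose F (x : wcar a) (h : forall y, wlt y x -> option (wcar b)) :
    option (wcar b) :=
  match pselect (exists z, good x h z /\ forall t, good x h t -> wle z t) with
  | left e => Some (sval (cid e))
  | right _ => None
  end.
pose f := Fix (@wlt_wf a) (fun=> option (wcar b)) F.
have fE x : f x = F x (fun y _ => f y).
  apply: Fix_eq => {}x g h gh; congr F.
  by apply: functional_extensionality_dep => y; apply/funext => yx; apply: gh.
have fS x z : f x = Some z ->
    (forall y, wlt y x -> f y <> Some z) /\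
    (forall t, (forall y, wlt y x -> f y <> Some t) -> wle z t).
  by rewrite fE /F; case: pselect => // e [<-]; case: cid.
have fN x : f x = None -> forall z, exists2 y, wlt y x & f y = Some z.
  rewrite fE /F; case: pselect => // ne _ z; apply: contrapT => nz.
  apply: ne.
  have [|t tg mint] := @wle_min b (fun z => good x (fun y _ => f y) z) z.
    by move=> y yx fy; apply: nz; exists y.
  by exists t.
have f_lt x y s t : f x = Some s -> f y = Some t -> wlt x y -> wlt s t.
  move=> fx fy xy; have [_ mins] := fS _ _ fx; have [ny _] := fS _ _ fy.
  apply/negP => ts; have : wle s t.
    apply: mins => z zx; apply: ny; apply/negP => yz.
    by move/negP: xy; apply; apply: wle_trans yz (wltW zx).
  by move=> /wle_anti /(_ ts) E; apply: (ny _ xy); rewrite fx E.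
have f_mono x y s t : f x = Some s -> f y = Some t -> wle s t = wle x y.
  move=> fx fy; apply/idP/idP => [st|xy].
    by apply: contraTT st => /(f_lt _ _ _ _ fy fx).
  apply/negPn/negP => /[dup] nts.
  have [yx|/negPn yx] := boolP (wlt x y).
    by have := wltW (f_lt _ _ _ _ fx fy yx) => -> .
  move: fy; rewrite -(wle_anti xy yx) fx => -[->].
  by rewrite wle_refl.
have f_down x s t : f x = Some s -> wle t s -> exists y, f y = Some t.
  move=> fx ts; apply: contrapT => nt.
  have [_ mins] := fS _ _ fx; have st : wle s t.
    by apply: mins => y _ fy; apply: nt; exists y.
  by apply: nt; exists x; rewrite fx (wle_anti st ts).
have [[x fx]|nN] := pselect (exists x, f x = None).
  right; have /choice[g gP] : forall z, exists y, f y = Some z.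
    by move=> z; have [y _ fy] := fN _ fx z; exists y.
  have [x0 fx0 minx0] := @wle_min a (fun x => f x = None) x fx.
  exists g; split=> [z t|z y ygz]; first by rewrite (f_mono _ _ _ _ (gP z) (gP t)).
  case E: (f y) => [t|].
    exists t; apply: wle_anti; first by rewrite -(f_mono _ _ _ _ (gP t) E) wle_refl.
    by rewrite -(f_mono _ _ _ _ E (gP t)) wle_refl.
  have [w wx0 fw] := fN _ fx0 z.
  have gzw : g z = w.
    by apply: wle_anti; rewrite -(f_mono _ _ _ _ (gP z) fw) ||
       rewrite -(f_mono _ _ _ _ fw (gP z)); rewrite wle_refl.
  move/negP: wx0; case; apply: wle_trans (minx0 _ E) _.
  by rewrite -gzw.
left; have /choice[g gP] : forall x, exists z, f x = Some z.
  by move=> x; case E: (f x) => [z|]; [exists z|case: nN; exists x].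
exists g; split=> [x y|x z zx]; first exact: f_mono.
have [y fy] := f_down _ _ _ (gP x) zx.
by exists y; move: fy; rewrite gP => -[].
Qed.

Definition wisob (a b : woset) : bool := `[< wiso a b >].

Lemma wisob_equiv : equiv_class_of wisob.
Proof.
split.
- by move=> a; apply/asboolP; apply/wisoP; split; apply: winit_refl.
- by move=> a b; apply/asboolP/asboolP => /wiso_sym.
- move=> b a c /asboolP /wisoP[ab ba] /asboolP /wisoP[bc cb].
  by apply/asboolP; apply/wisoP; split; apply: winit_trans; eauto.
Qed.

Canonical wisob_equiv_rel := EquivRelPack wisob_equiv.

Definition Ord := {eq_quot wisob}.
HB.instance Definition _ := Choice.on Ord.

Definition otype (a : woset) : Ord := \pi a.
Definition ord_rep (x : Ord) : woset := repr x.

Lemma ord_repK x : otype (ord_rep x) = x.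
Proof. exact: reprK. Qed.

Lemma eq_otype a b : otype a = otype b <-> wiso a b.
Proof.
split=> [/eqP|ab]; first by rewrite eqmodE => /asboolP.
by apply/eqP; rewrite eqmodE; apply/asboolP.
Qed.

Definition ord_le (x y : Ord) : bool := `[< winit (ord_rep x) (ord_rep y) >].

Lemma ord_le_refl : reflexive ord_le.
Proof. by move=> x; apply/asboolP; apply: winit_refl. Qed.

Lemma ord_le_anti : antisymmetric ord_le.
Proof.
move=> x y /andP[/asboolP xy /asboolP yx].
by rewrite -[x]ord_repK -[y]ord_repK; apply/eq_otype/winit_anti.
Qed.

Lemma ord_le_trans : transitive ord_le.
Proof.
by move=> y x z /asboolP xy /asboolP yz; apply/asboolP; apply: winit_trans yz.
Qed.

Lemma ord_le_total : total ord_le.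
Proof.
move=> x y; apply/orP.
by have [xy|yx] := winit_total (ord_rep x) (ord_rep y); [left|right]; apply/asboolP.
Qed.

Fact ord_display : Order.disp_t.
Proof. exact: Order.Disp tt tt. Qed.

HB.instance Definition _ :=
  Order.Le_isPOrder.Build ord_display Ord ord_le_refl ord_le_anti ord_le_trans.
HB.instance Definition _ :=
  Order.POrder_isTotal.Build ord_display Ord ord_le_total.

Lemma le_otype a b : (otype a <= otype b) = `[< winit a b >].
Proof.
have R c : winit (ord_rep (otype c)) c /\ winit c (ord_rep (otype c)).
  by apply/wisoP/eq_otype; rewrite ord_repK.
apply/asboolP/asboolP => ab.
  exact: winit_trans (R a).2 (winit_trans ab (R b).1).
exact: winit_trans (R a).1 (winit_trans ab (R b).2).
Qed.

Definition wseg (a : woset) (x : wcar a) : woset :=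
  Woset (@well_order_sub a (fun y => wlt y x)).

Lemma wseg_initial a (x : wcar a) : winitial (sval : wcar (wseg x) -> wcar a).
Proof.
split=> // -[y yx] z /= zy.
suff zx : wlt z x by exists (exist _ z zx).
by apply: contra yx => xz; apply: wle_trans zy.
Qed.

Lemma wseg_le a (x y : wcar a) : wle x y -> otype (wseg x) <= otype (wseg y).
Proof.
move=> xy; rewrite le_otype; apply/asboolP.
have H z : wlt z x -> wlt z y by apply: contra; apply: wle_trans.
exists (fun z => exist _ (sval z) (H _ (svalP z))); split=> // -[z zx] [t ty] /= tz.
have [[t' t'x] /= E] := (wseg_initial x).2 (exist _ z zx) t tz.
by exists (exist _ t' t'x); apply: eq_sig_hprop => // ? ? ?.
Qed.

Lemma wseg_lt_otype a (x : wcar a) : otype (wseg x) < otype a.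
Proof.
rewrite ltNge le_otype; apply/asboolP => -[f fi].
have E := winitial_uniq (winitial_comp fi (wseg_initial x)) (@winitial_id a).
by have := svalP (f x); move: (f_equal (@^~ x) E) => /= ->; rewrite /wlt wle_refl.
Qed.

Lemma wseg_inj a (x y : wcar a) : otype (wseg x) = otype (wseg y) -> x = y.
Proof.
have H (s t : wcar a) : otype (wseg s) = otype (wseg t) -> wle s t.
  move=> /eq_otype/wisoP[[f fi] _]; apply/negPn/negP => ts.
  have E := winitial_uniq (winitial_comp fi (wseg_initial t)) (wseg_initial s).
  have := svalP (f (exist _ t ts)).
  by move: (f_equal (@^~ (exist _ t ts)) E) => /= ->; rewrite /wlt wle_refl.
by move=> xy; apply: wle_anti; apply: H.
Qed.

Lemma lt_wseg (b : woset) (y : Ord) : y < otype b ->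
  exists x : wcar b, y = otype (wseg x).
Proof.
rewrite -[y]ord_repK; set a := ord_rep y; rewrite lt_neqAle => /andP[/eqP nab].
rewrite le_otype => /asboolP[f fi].
have [[z0 nz0]|fsurj] := pselect (exists z, forall x, f x <> z); last first.
  case: nab; apply/eq_otype; exists f; split; first by case: fi.
  have /choice[g gK] : forall z, exists x, f x = z.
    move=> z; apply: contrapT => nz; apply: fsurj; exists z => x fx.
    by apply: nz; exists x.
  by exists g => // x; apply: (wmono_inj fi.1).
have [z nz minz] := @wle_min b (fun z => forall x, f x <> z) z0 nz0.
exists z; apply/eq_otype.
have fz x : wlt (f x) z.
  by apply/negP => zfx; have [x' /nz] := fi.2 _ _ zfx.
exists (fun x => exist _ (f x) (fz x)); split; first by move=> s t /=; rewrite fi.1.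
have /choice[g gK] : forall t : wcar (wseg z), exists x, f x = sval t.
  move=> [t tz] /=; apply: contrapT => nt; move/negP: tz; apply.
  by apply: minz => x fx; apply: nt; exists x.
exists g => [x|[t tz]]; first by apply: (wmono_inj fi.1); rewrite gK.
by apply: eq_sig_hprop => [? ? ? //|]; rewrite /= gK.
Qed.

Lemma ord_wf (P : set Ord) : P !=set0 ->
  exists x, P x /\ forall y, P y -> x <= y.
Proof.
move=> [b0]; rewrite -[b0]ord_repK; set b := ord_rep b0 => Pb.
have [[x0 Px0]|nP] := pselect (exists x : wcar b, P (otype (wseg x))); last first.
  exists (otype b); split=> // y Py; rewrite leNgt; apply/negP => yb.
  by have [x yx] := lt_wseg yb; apply: nP; exists x; rewrite -yx.
have [x Px minx] := @wle_min b (fun x => P (otype (wseg x))) x0 Px0.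
exists (otype (wseg x)); split=> // y Py.
have [yb|by_] := ltP y (otype b).
  by have [t yt] := lt_wseg yb; rewrite yt; apply/wseg_le/minx; rewrite -yt.
by apply: le_trans by_; apply/ltW/wseg_lt_otype.
Qed.

Definition least (P : set Ord) (P0 : P !=set0) : Ord := sval (cid (ord_wf P0)).

(* As usual, an ordinal is identified with the set of smaller ordinals; it
   carries the order topology. *)
Definition seg (b : Ord) : Type := {x : Ord | x < b}.
Coercion seg : Ord >-> Sortclass.

HB.instance Definition _ (b : Ord) := SubChoice.on (seg b).
HB.instance Definition _ (b : Ord) :=
  [SubChoice_isSubOrder of seg b by <: with ord_display].
HB.instance Definition _ (b : Ord) :=
  OrderTopological.copy (seg b) (order_topology (seg b)).

Lemma well_order_nat : well_order (fun m n : nat => (m <= n)%N).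
Proof.
apply: antisymmetric_well_order; first by move=> m n; rewrite -eqn_leq => /eqP.
move=> A [m Am]; have exA : exists n, n \in A by exists m.
by case: (ex_minnP exA) => n An minn; exists n.
Qed.

(* Not built from the ordinal type of fintype, whose universe is too large
   for the carrier of a woset. *)
Definition ordn (n : nat) : Ord := otype (@wseg (Woset well_order_nat) n).

Lemma hartogs (A : Type) : exists b : Ord, ~ exists f : b -> A, injective f.
Proof.
have [R Rwo] := @well_ordering_principle {classic (A -> Prop)}.
exists (otype (@Woset (A -> Prop) R Rwo)) => -[f finj].
pose g (P : A -> Prop) : A :=
  f (exist (fun x => x < _) _ (@wseg_lt_otype (@Woset (A -> Prop) R Rwo) P)).
have ginj : injective g.
  by move=> P Q /finj /(f_equal val) /= /wseg_inj.
pose D x := exists P : A -> Prop, g P = x /\ ~ P x.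
have nD : ~ D (g D) by move=> /[dup] dD [P [/ginj ->]]; apply.
by apply: (nD); exists D; split.
Qed.

Lemma card_leTP (S T : Type) :
  [set: S] #<= [set: T] <-> exists f : S -> T, injective f.
Proof.
split=> [/card_leP[f]|[f finj]].
  exists (fun x => val (f (exist _ x (mem_setT x)))) => x y /val_inj.
  by move=> /(inj (mem_setT _) (mem_setT _)) [].
have /injPex[g] : exists f : S -> T, set_inj [set: S] f by exists f => x y _ _ /finj.
by rewrite -(card_le_eql (card_image g)); apply: card_leT.
Qed.

Lemma card_le_seg (a b : Ord) : a <= b -> [set: a] #<= [set: b].
Proof.
move=> ab; apply/card_leTP.
exists (fun x : a => exist (fun x => x < b) (val x) (lt_le_trans (valP x) ab)).
by move=> x y /(f_equal val) /= /val_inj.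
Qed.

Lemma card_seg_rep (b : Ord) : exists f : b -> wcar (ord_rep b), injective f.
Proof.
have /choice[f fP] : forall x : b, exists y : wcar (ord_rep b),
    val x = otype (wseg y).
  by move=> x; apply: lt_wseg; rewrite ord_repK; exact: (svalP x).
by exists f => x y fxy; apply: val_inj; rewrite !fP fxy.
Qed.

Lemma uncountable_ord : [set b : Ord | ~ countable [set: b]] !=set0.
Proof. by have [b nb] := hartogs nat; exists b => /card_leTP. Qed.

Definition omega1 : Ord := least uncountable_ord.

(* Cardinals are initial ordinals. *)
Definition is_cardinal (k : Ord) : Prop :=
  forall a : Ord, a < k -> ~ ([set: a] #= [set: k]).

Lemma larger_cardinal (k : Ord) : [set b | is_cardinal b /\ k < b] !=set0.
Proof.
have P0 : [set b : Ord | ~ ([set: b] #<= [set: k])] !=set0.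
  have [b nb] := hartogs (wcar (ord_rep k)); exists b => /card_leTP[f finj].
  by have [g ginj] := card_seg_rep k; apply: nb; exists (g \o f); apply: inj_comp.
have [b [/= nb minb]] := ord_wf P0; exists b; split=> [a ab aeb|].
  apply: nb; rewrite -(card_le_eql aeb); apply: contrapT => /minb.
  by rewrite leNgt ab.
by rewrite ltNge; apply/negP => /card_le_seg.
Qed.

Definition card_succ (k : Ord) : Ord := least (larger_cardinal k).

Definition homeomorphic (S T : topologicalType) : Prop :=
  exists (f : S -> T) (g : T -> S),
    [/\ cancel f g, cancel g f, continuous f & continuous g].

(* A set X of points of b is seen as a space through the coercion set_type,
   which carries the subspace topology. *)
Definition top_arrow (k : Ord) (alpha : k -> Ord) (b : Ord) : Prop :=
  forall c : b -> k, exists (i : k) (X : set b),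
    X `<=` c @^-1` [set i] /\ homeomorphic (alpha i) X.

(* None stands for infinity; the ordinals are well-ordered, so a least b
   exists as soon as some b does. *)
Definition Ptop (k : Ord) (alpha : k -> Ord) : option Ord :=
  if pselect ([set b | top_arrow alpha b] !=set0) is left ex
  then Some (least ex) else None.

(* Main.v *)
Require Import Defs.
From mathcomp Require Import all_boot all_order.
From mathcomp Require Import all_classical topology.
From mathcomp Require Import interval wochoice.

Set Implicit Arguments.
Unset Strict Implicit.
Unset Printing Implicit Defensive.

Import Order.TTheory.
Local Open Scope classical_set_scope.
Local Open Scope card_scope.
Local Open Scope order_scope.

(* Let l = max(omega_1, kappa^+). Below l the constant colouring r or an
   injective colouring avoids every alpha_i. Since every infinite cardinal
   equals its square, families of at most max(omega, kappa) elements of l are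
   bounded. Given c : l -> kappa, if a class i <> r is stationary among the
   points of cofinality omega, Friedman's theorem yields closed copies of all
   countable ordinals in it. Otherwise each class i <> r misses the points of
   cofinality omega closed under some h_i : l -> l; for an h bounding all the
   h_i, the points of cofinality omega closed under h have colour r, and their
   first omega_1 elements form a copy of omega_1, since at countable limits
   suprema of such points are again such points. *)

(** * Injections between types, and squares of infinite well-ordered sets *)

Definition injects (S T : Type) := exists f : S -> T, injective f.

Lemma injects_trans T S U : injects S T -> injects T U -> injects S U.
Proof. by move=> [f fi] [g gi]; exists (g \o f); apply: inj_comp. Qed.

Lemma injects_prod S S' T T' :
  injects S S' -> injects T T' -> injects (S * T) (S' * T').
Proof.
move=> [f fi] [g gi]; exists (fun p => (f p.1, g p.2)).
by move=> [x y] [x' y'] [/fi -> /gi ->].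
Qed.

Lemma injects_countable T : injects T nat <-> countable [set: T].
Proof. by split=> /card_leTP. Qed.

Lemma injects_nat_infinite T : injects nat T <-> infinite_set [set: T].
Proof. by rewrite infiniteP; split=> /card_leTP. Qed.

Lemma injects_finite S T :
  injects S T -> finite_set [set: T] -> finite_set [set: S].
Proof. by move=> /card_leTP; apply: card_le_finite. Qed.

Lemma finite_option T : finite_set [set: T] -> finite_set [set: option T].
Proof.
move=> fT; suff -> : [set: option T] = [set None] `|` Some @` [set: T].
  by rewrite finite_setU; split; [apply: finite_set1|apply: finite_image].
by apply/seteqP; split=> // -[x|] _; [right; exists x|left].
Qed.

(** Two distinct elements of [M] serve as tags: [M * M] has room for a copy of [M] and one more
    point. *)
Lemma injects_option M :
  injects nat M -> injects (M * M) M -> injects (option M) M.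
Proof.
move=> [g gi]; apply: injects_trans.
exists (fun o => if o is Some x then (g 1, x) else (g 0, g 0)).
by move=> [x|] [y|] //=; [case=> ->|case=> /gi|case=> /gi].
Qed.

Section PairOrder.
Variable a : woset.
Implicit Types p q : wcar a * wcar a.

Let mx p := if wle p.1 p.2 then p.2 else p.1.

Let mx1 p : wle p.1 (mx p).
Proof. by rewrite /mx; case: ifP => // _; apply: wle_refl. Qed.

Let mx2 p : wle p.2 (mx p).
Proof.
rewrite /mx; case: ifP => [_|h]; first exact: wle_refl.
by have := wle_total p.1 p.2; rewrite h.
Qed.

(* Goedel's well-ordering of pairs: by maximum first, so that the pairs below
   [p] lie in the square of a proper initial segment. *)
Definition pair_le p q := wle (mx p) (mx q) &&
  (wle (mx q) (mx p) ==> wle p.1 q.1 && (wle q.1 p.1 ==> wle p.2 q.2)).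

Lemma well_order_pair : well_order pair_le.
Proof.
apply: antisymmetric_well_order.
  move=> [x y] [x' y'] /andP[/andP[h1 /implyP h2] /andP[h3 /implyP h4]].
  have /andP[/= h5 /implyP h6] := h2 h3; have /andP[/= h7 /implyP h8] := h4 h1.
  by rewrite (wle_anti h5 h7) (wle_anti (h6 h7) (h8 h5)).
move=> A [p0 Ap0].
have [m [p1 Ap1 mp1] minm] := @wle_min a
  (fun m => exists2 p, p \in A & mx p = m)
  (mx p0) ltac:(by exists p0).
have [x [p2 Ap2 [mp2 xp2]] minx] := @wle_min a
  (fun x => exists2 p, p \in A & mx p = m /\ p.1 = x) p1.1 ltac:(by exists p1).
have [y [p3 Ap3 [mp3 xp3 yp3]] miny] := @wle_min a
  (fun y => exists2 p, p \in A & [/\ mx p = m, p.1 = x & p.2 = y]) p2.2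
  ltac:(by exists p2).
exists p3; split=> // q Aq; rewrite /pair_le mp3 xp3 yp3.
have mq : wle m (mx q) by apply: minm; exists q.
rewrite mq; apply/implyP => /(wle_anti mq) mE.
have xq : wle x q.1 by apply: minx; exists q.
rewrite xq; apply/implyP => /(wle_anti xq) xE.
by apply: miny; exists q.
Qed.

Lemma pair_le_bound p : exists m, forall q, pair_le q p -> wle q.1 m /\ wle q.2 m.
Proof.
exists (mx p) => q /andP[qp _].
by split; [apply: wle_trans (mx1 q) qp|apply: wle_trans (mx2 q) qp].
Qed.

End PairOrder.

(** The endpoint [m] becomes [None]: a closed segment has just one point more than the open one. *)
Lemma injects_le_option (a : woset) (m : wcar a) :
  injects {x : wcar a | wle x m} (option (wcar (wseg m))).
Proof.
have /choice[f fP] : forall x : {x : wcar a | wle x m},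
    exists o : option (wcar (wseg m)),
      if o is Some y then sval y = sval x else sval x = m.
  move=> [x xm]; have [mx|mx] := boolP (wle m x).
    by exists None; apply: wle_anti.
  by exists (Some (exist _ x mx)).
exists f => x y fxy; have := fP x; have := fP y; rewrite fxy => h1 h2.
apply: eq_sig_hprop; first by move=> ? ? ?.
by move: h1 h2; case: (f y) => [z <-|-> ->].
Qed.

(** In a counterexample [c] of least order type, the order [G] on pairs is longer than [c]. So [c]
    is isomorphic to a proper initial segment of [G] and embeds into the square of a closed segment
    of [c], which minimality rules out. *)
Lemma infinite_square (a : woset) :
  injects nat (wcar a) -> injects (wcar a * wcar a) (wcar a).
Proof.
move=> nata; apply: contrapT => nsqa.
have [b0 [[c [<- natc nsqc]] minb]] := ord_wf (P := [set b | exists c,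
  [/\ otype c = b, injects nat (wcar c) & ~ injects (wcar c * wcar c) (wcar c)]])
  ltac:(by exists (otype a); exists a).
(* A finite segment has a finite square. An infinite one satisfies the claim by minimality; with [c]
   inside its square, [c * c] would inject into [c]. *)
have small (x : wcar c) : ~ injects (wcar c) (wcar (wseg x) * wcar (wseg x)).
  move=> cxx.
  have natx : injects nat (wcar (wseg x)).
    apply/injects_nat_infinite => fx; move/injects_nat_infinite: natc; apply.
    by apply: injects_finite cxx _; rewrite -setXTT; apply: finite_setX.
  have [sqx|nsqx] := pselect (injects (wcar (wseg x) * wcar (wseg x)) (wcar (wseg x))).
    have xc : injects (wcar (wseg x)) (wcar c).
      by exists sval; apply: wmono_inj (wseg_initial x).1.
    have cx := injects_trans cxx sqx.
    apply: nsqc.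
    exact: injects_trans (injects_prod cx cx) (injects_trans sqx xc).
  have := wseg_lt_otype x; rewrite ltNge => /negP; apply.
  by apply: minb; exists (wseg x).
pose G := Woset (@well_order_pair c).
have [cG|Gc] := leP (otype G) (otype c).
  move: cG; rewrite le_otype => /asboolP[f [fm _]]; apply: nsqc.
  by exists f; apply: wmono_inj fm.
have [p /eq_otype[f [fm _]]] := lt_wseg Gc.
have [m mP] := pair_le_bound p.
pose K := {x : wcar c | wle x m}.
have cKK : injects (wcar c) (K * K).
  have bd x : wle (sval (f x)).1 m /\ wle (sval (f x)).2 m.
    by apply: mP; apply: wltW (svalP (f x)).
  exists (fun x => (exist (fun z => wle z m) _ (bd x).1,
                    exist (fun z => wle z m) _ (bd x).2)) => x y [e1 e2].
  apply: (wmono_inj fm); apply: eq_sig_hprop; first by move=> ? ? ?.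
  by case: (sval (f x)) (sval (f y)) e1 e2 => [? ?] [? ?] /= -> ->.
have Ko := injects_le_option m.
have coo := injects_trans cKK (injects_prod Ko Ko).
(* If the segment below [m] is finite, so is [c]; otherwise the endpoint is absorbed. *)
have [natm|] := pselect (injects nat (wcar (wseg m))); last first.
  move=> /injects_nat_infinite /contrapT fm'.
  move/injects_nat_infinite: natc; apply.
  apply: injects_finite coo _; rewrite -setXTT.
  by apply: finite_setX; apply: finite_option.
have [sqm|nsqm] := pselect (injects (wcar (wseg m) * wcar (wseg m)) (wcar (wseg m))).
  have om := injects_option natm sqm.
  exact: small (injects_trans coo (injects_prod om om)).
have := wseg_lt_otype m; rewrite ltNge => /negP; apply.
by apply: minb; exists (wseg m).
Qed.

Lemma rep_injects_seg (b : Ord) : injects (wcar (ord_rep b)) b.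
Proof.
have lt (x : wcar (ord_rep b)) : otype (wseg x) < b.
  by rewrite -[ltRHS]ord_repK; apply: wseg_lt_otype.
exists (fun x => exist (fun y => y < b) _ (lt x)) => x y /(f_equal val) /=.
exact: wseg_inj.
Qed.

Lemma seg_square (b : Ord) : injects nat b -> injects (b * b) b.
Proof.
have br : injects b _ := card_seg_rep b; have rb := rep_injects_seg b.
move=> natb; have sq := infinite_square (injects_trans natb br).
exact: injects_trans (injects_prod br br) (injects_trans sq rb).
Qed.

Lemma seg_injects (a b : Ord) : a <= b -> injects a b.
Proof. by move=> /card_le_seg/card_leTP. Qed.

Lemma lt_ord_wf : well_founded (fun x y : Ord => x < y).
Proof.
move=> x; apply: contrapT => nx.
have [y [/= ny miny]] := ord_wf (ex_intro [set x | ~ Acc _ x] x nx).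
apply: ny; constructor => z zy; apply: contrapT => nz; have := miny z nz.
by rewrite leNgt zy.
Qed.

(** * Sizes of ordinals below omega_1 and kappa^+, and cofinality *)

Lemma lt_omega1 (b : Ord) : b < omega1 -> injects b nat.
Proof.
move=> blt; apply/injects_countable; apply: contrapT => nc; move: blt.
rewrite /omega1 /least; case: cid => w [_ /(_ _ nc)] /= wb.
by rewrite ltNge wb.
Qed.

Lemma omega1_uncountable : ~ injects omega1 nat.
Proof.
move/injects_countable; rewrite /omega1 /least.
by case: cid => w [].
Qed.

(** The least ordinal [b0] that does not inject into [k] is a cardinal above [k], hence
    [card_succ k <= b0]. *)
Lemma lt_card_succ (k b : Ord) : b < card_succ k -> injects b k.
Proof.
move=> blt; apply: contrapT => nbk.
have [b0 [/= nb0 minb0]] := ord_wf (ex_intro [set b : Ord | ~ injects b k] b nbk).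
have : card_succ k <= b0.
  rewrite /card_succ /least; case: cid => w [_ /= minw]; apply: minw; split.
    move=> a ab0 /card_eqPle [_ /card_leTP b0a].
    have : injects a k by apply: contrapT => /minb0; rewrite leNgt ab0.
    by move=> ak; apply: nb0; apply: injects_trans ak.
  by rewrite ltNge; apply/negP => /seg_injects.
by rewrite leNgt (le_lt_trans (minb0 _ nbk) blt).
Qed.

Lemma card_succ_not_injects (k : Ord) : ~ injects (card_succ k) k.
Proof.
rewrite /card_succ /least; case: cid => w [[wc kw] _] /= wk.
apply: (wc _ kw); rewrite card_eqPle; split; last exact/card_leTP.
exact/card_le_seg/ltW.
Qed.

(* The common size of kappa and omega is represented by a type M, so that
   both cases of the maximum are treated at once. *)
Lemma small_type (k : Ord) : exists M : Type,
  [/\ injects nat M, injects k M, injects (M * M) M,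
      forall b : Ord, b < Order.max omega1 (card_succ k) -> injects b M &
      ~ injects (Order.max omega1 (card_succ k) : Ord) M].
Proof.
have [kc|knc] := pselect (injects k nat).
  exists nat; split=> //; first by exists id.
  - by have := card_nat2; rewrite card_eqPle => -[/card_leTP].
  - move=> b; rewrite lt_max => /orP[/lt_omega1 //|/lt_card_succ bk].
    exact: injects_trans bk kc.
  - move=> h; apply: omega1_uncountable; apply: injects_trans h.
    by apply: seg_injects; rewrite le_max lexx.
have natk : injects nat k.
  apply/injects_nat_infinite => /finite_set_countable.
  by move/injects_countable.
exists k; split=> //; first by exists id.
- exact: seg_square.
- move=> b; rewrite lt_max => /orP[/lt_omega1 h|/lt_card_succ //].
  exact: injects_trans h natk.
- move=> h; apply: (@card_succ_not_injects k); apply: injects_trans h.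
  by apply: seg_injects; rewrite le_max lexx orbT.
Qed.

(** For infinite [M], this expresses that [l] is a limit whose cofinality exceeds the size of
    [M]. *)
Definition bounds_families (M : Type) (l : Ord) : Prop :=
  forall (I : Type) (u : I -> Ord), injects I M -> (forall i, u i < l) ->
  exists2 b, b < l & forall i, u i < b.

(** If [u] were unbounded, each [b] in [l] would be at most some [u i], and could be recovered from
    [i] and its position in [u i]. This would inject [l] into [I * option M], hence into [M]. *)
Lemma bounds_families_not_injects (M : Type) (l : Ord) :
    injects nat M -> injects (M * M) M ->
    (forall b : Ord, b < l -> injects b M) -> ~ injects l M ->
  bounds_families M l.
Proof.
move=> natM sqM lM nlM I u IM ul; apply: contrapT => nb; apply: nlM.
have /choice[j jP] : forall b : l, exists i, val b <= u i.
  move=> b; apply: contrapT => ni; apply: nb.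
  exists (val b); first exact: valP b.
  by move=> i; rewrite ltNge; apply/negP => h; apply: ni; exists i.
pose e i : u i -> M := sval (cid (lM _ (ul i))).
have ei i : injective (e i) := svalP (cid (lM _ (ul i))).
(* [None] records the case where [b] equals [u (j b)]. *)
pose code (b : l) : option M :=
  match pselect (val b < u (j b)) with
  | left h => Some (e (j b) (exist (fun x => x < u (j b)) _ h))
  | right _ => None
  end.
suff ci : injects l (I * option M).
  have oM := injects_option natM sqM.
  by apply: injects_trans ci (injects_trans (injects_prod IM oM) sqM).
exists (fun b => (j b, code b)) => x y []; rewrite /code.
case: pselect => hx; case: pselect => hy //= jxy.
  move: hx hy; rewrite jxy.
  move=> hx hy [] /ei /(f_equal val) /= xy; exact: val_inj.
move=> _; apply: val_inj => /=.
have E (z : l) : ~ val z < u (j z) -> val z = u (j z).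
  by move=> h; apply/eqP; rewrite eq_le jP /= leNgt; apply/negP.
by rewrite (E x hx) (E y hy) jxy.
Qed.

(** * Closure points, stationary sets and Friedman's theorem *)

Definition limit_ord (x : Ord) : Prop :=
  (exists y, y < x) /\ forall y, y < x -> exists2 z, y < z & z < x.

(** A normal function on an initial segment [D]: the last clause, continuity at limits, makes it a
    homeomorphism onto its image. Values outside [D] are free, which avoids dependent types. *)
Definition ordinal_copy (D S : set Ord) (f : Ord -> Ord) : Prop :=
  [/\ forall x, D x -> S (f x),
      forall x y, x < y -> D y -> f x < f y &
      forall x, D x -> limit_ord x -> forall z, z < f x ->
        exists2 y, y < x & z < f y].

(* Only points of countable cofinality count, in [stationary] as well. *)
Definition closure_point (h : Ord -> Ord) (d : Ord) : Prop :=
  (forall x, x < d -> h x < d) /\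
  exists e : nat -> Ord, (forall n, e n < d) /\
    forall z, z < d -> exists n, z < e n.

Definition stationary (l : Ord) (S : set Ord) : Prop :=
  forall h : Ord -> Ord, (forall x, x < l -> h x < l) ->
  exists d, [/\ d < l, closure_point h d & S d].

Lemma countable_enum (a : Ord) : injects a nat ->
  exists e : nat -> Ord, forall x, x < a -> exists n, e n = x.
Proof.
move=> [f fi].
have /choice[e eP] : forall n, exists x : Ord, forall y : a, f y = n -> x = val y.
  move=> n; have [[y fy]|ny] := pselect (exists y, f y = n).
    by exists (val y) => z fz; congr val; apply: fi; rewrite fy fz.
  by exists a => y fy; case: ny; exists y.
by exists e => x xa; exists (f (exist _ x xa)); rewrite (eP _ _ erefl).
Qed.

(** The next term is taken beyond both [h] of the current one and the [n]-th term of the given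
    cofinal sequence, so the new sequence is still cofinal. *)
Lemma closure_point_seq (h : Ord -> Ord) (d : Ord) : closure_point h d ->
  exists t : nat -> Ord, [/\ forall n, t n < d, forall n, h (t n) < t n.+1 &
    forall z, z < d -> exists n, z < t n].
Proof.
move=> [hd [e [ed ecof]]].
have /choice[nx nxP] : forall p : Ord * nat, exists y, p.1 < d ->
    [/\ y < d, h p.1 < y & e p.2 < y].
  move=> [x n] /=; have [xd|nxd] := boolP (x < d); last by exists x.
  have [|m hm] := ecof (Order.max (h x) (e n)).
    by rewrite gt_max (hd _ xd) ed.
  exists (e m) => _; split=> //; apply: le_lt_trans hm.
    by rewrite le_max lexx.
  by rewrite le_max lexx orbT.
pose t := fix t n := if n is m.+1 then nx (t m, m) else e 0%N.
have td n : t n < d by elim: n => [|n IH] //=; have [] := nxP (t n, n) IH.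
exists t; split=> // [n|z zd]; first by have [] := nxP (t n, n) (td n).
have [n zn] := ecof z zd; exists n.+1.
by apply: lt_trans zn _; have [] := nxP (t n, n) (td n).
Qed.

Lemma ltn_mono_seq (t : nat -> Ord) : (forall n, t n < t n.+1) ->
  forall m n, (m <= n)%N -> t m <= t n.
Proof.
move=> tS m n; elim: n => [|n IH]; first by rewrite leqn0 => /eqP ->.
rewrite leq_eqVlt => /orP[/eqP -> //|mn].
by apply: le_trans (IH mn) (ltW (tS n)).
Qed.

(** Finitely many points below a limit are bounded strictly below it. This controls first indices
    along an enumeration near the limit. *)
Lemma limit_ord_above (x : Ord) (e : nat -> Ord) n : limit_ord x ->
  exists2 y, y < x & forall k, (k < n)%N -> e k < x -> e k < y.
Proof.
move=> [x0 xl]; elim: n => [|n [y yx IH]]; first by have [y yx] := x0; exists y.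
have [enx|enx] := boolP (e n < x); last first.
  exists y => // k; rewrite ltnS leq_eqVlt => /orP[/eqP ->|/IH //].
  by rewrite (negPf enx).
have [|w mw wx] := xl (Order.max y (e n)); first by rewrite gt_max yx enx.
move: mw; rewrite gt_max => /andP[yw ew].
exists w => // k; rewrite ltnS leq_eqVlt => /orP[/eqP -> //|kn ekx].
exact: lt_trans (IH _ kn ekx) yw.
Qed.

(* Friedman's theorem, by induction on [a]: copies of the smaller ordinals,
   placed in consecutive intervals of a sequence converging to a closure point
   [d] in [S], have [d] as their only new limit. *)
Lemma stationary_copy (M : Type) (l : Ord) (S : set Ord) :
  injects nat M -> bounds_families M l -> (forall x, S x -> x < l) ->
  stationary l S -> forall a, a < omega1 -> forall g, g < l ->
  exists f, ordinal_copy [set x | x <= a] (S `&` [set x | g < x]) f.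
Proof.
move=> natM bnd Sl Sst a; elim/(well_founded_ind lt_ord_wf): a => a IH aw g gl.
have [e eP] := countable_enum (lt_omega1 aw).
(* [F (x, b)] copies the closed segment up to [b] above [x]; [id] is a default outside the relevant
   range. *)
have /choice[F FP] : forall p : Ord * Ord, exists f, p.1 < l -> p.2 < a ->
    ordinal_copy [set x | x <= p.2] (S `&` [set x | p.1 < x]) f.
  move=> [x b] /=; have [xl|nxl] := pselect (x < l); last by exists id.
  have [ba|nba] := pselect (b < a); last by exists id.
  by have [f fP] := IH b ba (lt_trans ba aw) x xl; exists f.
(* The tops of the copies [F (x, b)] are countably many, so [h x] can exceed them all. *)
have /choice[h hP] : forall x, exists y, x < l ->
    [/\ y < l, g < y, x < y & forall b, b < a -> F (x, b) b < y].
  move=> x; have [xl|nxl] := pselect (x < l); last by exists x.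
  pose u n := if n is m.+1 then (if e m < a then F (x, e m) (e m) else x)
              else Order.max g x.
  have [|y yl uy] := @bnd nat u natM.
    case=> [|m] /=; first by rewrite gt_max gl.
    case: ifP => // ea; have [/(_ _ (lexx _))[/Sl + _] _ _] := FP (x, e m) xl ea.
    exact.
  exists y => _; split=> // [||b ba].
  - by apply: le_lt_trans (uy 0%N); rewrite /= le_max lexx.
  - by apply: le_lt_trans (uy 0%N); rewrite /= le_max lexx orbT.
  - by have [m em] := eP b ba; have := uy m.+1; rewrite /= em ba.
have [d [dl hd Sd]] := Sst h (fun x xl => let: And4 H _ _ _ := hP x xl in H).
have [t [td ht tcof]] := closure_point_seq hd.
have tl n : t n < l := lt_trans (td n) dl.
have tS n : t n < t n.+1.
  by apply: lt_trans (ht n); have [] := hP _ (tl n).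
have tle := ltn_mono_seq tS.
have gt n : g < t n.+1.
  by apply: lt_trans (ht n); have [] := hP _ (tl n).
(* The first index [n] with [x <= e n < a] cuts [a] into consecutive intervals, each ending at some
   [e n]. *)
have /choice[N NP] : forall x, exists n, x < a ->
    [/\ x <= e n, e n < a & forall k, (k < n)%N -> e k < a -> e k < x].
  move=> x; have [xa|nxa] := pselect (x < a); last by exists 0%N.
  have ex : exists n, x <= e n < a.
    by have [n en] := eP x xa; exists n; rewrite en lexx.
  case: (ex_minnP ex) => n /andP[xn na] minn; exists n => _; split=> // k kn ka.
  rewrite ltNge; apply/negP => xk; have := minn k.
  by rewrite xk ka leqNgt kn => /(_ isT).

(* The interval of index [n] is mapped between [t n.+1] and [t n.+2]; the shift is there because
   [t 0] may fail to exceed [g]. *)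
pose f x := if x < a then F (t (N x).+1, e (N x)) x else d.
have fE x : x < a -> f x = F (t (N x).+1, e (N x)) x by rewrite /f => ->.
have copyN x : x < a -> ordinal_copy [set y | y <= e (N x)]
    (S `&` [set y | t (N x).+1 < y]) (F (t (N x).+1, e (N x))).
  by move=> xa; have [_ ea _] := NP x xa;
    exact: (FP (t (N x).+1, e (N x)) (tl _) ea).
have f_gt x : x < a -> t (N x).+1 < f x.
  move=> xa; have [xe _ _] := NP x xa; rewrite fE //.
  by have [/(_ x xe)[]] := copyN x xa.
have f_lt x : x < a -> f x < t (N x).+2.
  move=> xa; have [xe ea _] := NP x xa; have [_ mono _] := copyN x xa.
  apply: lt_trans (ht _); rewrite fE //.
  have [_ _ _ /(_ _ ea)] := hP _ (tl (N x).+1); apply: le_lt_trans.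
  move: xe; rewrite le_eqVlt => /orP[/eqP xe|xe].
    by rewrite [X in F _ X <= _]xe.
  exact: ltW (mono _ _ xe (lexx _)).
have N_mono x y : x < y -> y < a -> (N x <= N y)%N.
  move=> xy ya; have [ye ea _] := NP y ya.
  have [xe _ minN] := NP x (lt_trans xy ya); rewrite leqNgt; apply/negP => /minN.
  by move=> /(_ ea); rewrite ltNge (ltW (lt_le_trans xy ye)).
have fa : f a = d by rewrite /f ltxx.
have f_mono x y : x < y -> y <= a -> f x < f y.
  move=> xy; rewrite le_eqVlt => /orP[/eqP ya|ya].
    by rewrite ya fa; apply: lt_trans (f_lt _ _) (td _); rewrite -ya.
  have xa := lt_trans xy ya; have := N_mono _ _ xy ya.
  rewrite leq_eqVlt => /orP[/eqP Nxy|Nxy].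
    have [_ + _] := copyN y ya; have [ye _ _] := NP y ya.
    by move=> /(_ _ _ xy ye); rewrite !fE // Nxy.
  exact: lt_trans (f_lt _ xa) (le_lt_trans (tle _ _ _) (f_gt _ ya)).
exists f; split=> [x||x xa xlim z].
- rewrite /= le_eqVlt => /orP[/eqP ->|xa].
    by rewrite fa; split=> //; apply: lt_trans (gt 0%N) (td _).
  split; last exact: lt_trans (gt _) (f_gt _ xa).
  have [xe _ _] := NP x xa; rewrite fE //.
  by have [/(_ x xe)[]] := copyN x xa.
- by move=> x y xy /= ya; apply: f_mono.
move: xa; rewrite /= le_eqVlt => /orP[/eqP xa|xa].
  (* At the limit [a], points beyond the first [n] terms of [e] have index at least [n], so their
     images exceed [t n]. *)
  rewrite xa fa => /tcof[n zn]; rewrite -xa.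
  have [y yx ye] := @limit_ord_above x e n xlim; exists y => //.
  apply: lt_trans zn (le_lt_trans (tle _ _ _) (f_gt y _)); last by rewrite -xa.
  apply: leqW; rewrite leqNgt; apply/negP => /ye.
  have ya : y < a by rewrite -xa.
  have [yN Na _] := NP y ya.
  by rewrite xa => /(_ Na); rewrite ltNge yN.
(* From [y1] on, the points below [x] share the index of [x], so continuity of a single copy
   suffices. *)
move=> zf; have [xe ea minN] := NP x xa.
have [y1 y1x ye] := @limit_ord_above x e (N x) xlim.
have [_ mono cont] := copyN x xa.
have [|y2 y2x zy2] := cont x xe xlim z; first by rewrite -fE.
pose y := Order.max y1 y2.
have yx : y < x by rewrite gt_max y1x.
have ya := lt_trans yx xa.
exists y => //; rewrite fE //.
have -> : N y = N x.
  apply/eqP; rewrite eqn_leq N_mono //= leqNgt; apply/negP => Nyx.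
  have [yN Na _] := NP y ya.
  have := ye _ Nyx (minN _ Nyx Na); rewrite ltNge (le_trans _ yN) //.
  by rewrite le_max lexx.
apply: lt_le_trans zy2 _.
have : y2 <= y by rewrite le_max lexx orbT.
rewrite le_eqVlt => /orP[/eqP <- //|y2y].
by apply/ltW/mono => //; apply: le_trans (ltW yx) xe.
Qed.

(** * From normal functions to homeomorphisms *)

Lemma continuous_rays d (T : topologicalType) (U : orderTopologicalType d)
    (f : T -> U) :
  (forall b, open [set x | f x < b]) -> (forall b, open [set x | b < f x]) ->
  continuous f.
Proof.
move=> fl fr x A; rewrite itv_nbhsE => -[i [oi xi] iA].
suff of_ : open (f @^-1` [set` i]).
  rewrite nbhs_simpl /=; apply: (filterS (P := f @^-1` [set` i])).
    by move=> y; apply: iA.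
  exact: open_nbhs_nbhs.
(* An open interval is a ray, an intersection of two rays, or everything. *)
case: i oi {xi iA} => -[bl l|bl] [br r|br] oi.
- have bE := itv_open_ends_rside oi; have bE' := itv_open_ends_lside oi; subst.
  rewrite (_ : _ @^-1` _ = [set x | l < f x] `&` [set x | f x < r]).
    exact: openI.
  by apply/seteqP; split=> y /=; rewrite in_itv /= => /andP.
- have bE := itv_open_ends_rinfty oi; have bE' := itv_open_ends_lside oi; subst.
  rewrite (_ : _ @^-1` _ = [set x | l < f x]) //.
  by apply/seteqP; split=> y /=; rewrite in_itv /= andbT.
- have bE := itv_open_ends_rside oi; have bE' := itv_open_ends_linfty oi; subst.
  rewrite (_ : _ @^-1` _ = [set x | f x < r]) //.
- have bE := itv_open_ends_rinfty oi; have bE' := itv_open_ends_linfty oi; subst.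
  rewrite (_ : _ @^-1` _ = setT); first exact: openT.
  by apply/seteqP; split=> y.
Qed.

(** The set is everything or the open ray below its first missing point. *)
Lemma open_below (a : Ord) (P : set Ord) :
  (forall x y, x < y -> P y -> P x) -> open [set x : a | P (val x)].
Proof.
move=> Pdown; have [[x0 nPx0]|allP] := pselect (exists x : a, ~ P (val x)).
  have [m [[x nPx xm] minm]] := ord_wf
    (P := [set v | exists2 x : a, ~ P (val x) & val x = v])
    ltac:(by exists (val x0); exists x0).
  rewrite (_ : [set _ | _] = [set` `]-oo, x[]); first exact: lray_open.
  apply/seteqP; split=> y /=; rewrite in_itv /= => h.
    rewrite ltNge; apply/negP; rewrite le_eqVlt => /orP[/eqP E|xy].
      by apply: nPx; rewrite E.
    exact: nPx (Pdown _ _ xy h).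
  apply: contrapT => nPy; have := minm (val y) ltac:(by exists y).
  by rewrite -xm leNgt => /negP; apply.
rewrite (_ : [set _ | _] = setT); first exact: openT.
apply/seteqP; split=> y //= _; apply: contrapT => nPy; apply: allP.
by exists y.
Qed.

(** The least point of a nonempty such set is not a limit. If it is a successor, the set is the open
    ray above its predecessor; if it is zero, the set is everything. *)
Lemma open_above (a : Ord) (P : set Ord) :
  (forall x y, x < y -> P x -> P y) ->
  (forall x, x < a -> limit_ord x -> P x -> exists2 y, y < x & P y) ->
  open [set x : a | P (val x)].
Proof.
move=> Pup Plim.
have [[x0 Px0]|noP] := pselect (exists x : a, P (val x)); last first.
  rewrite (_ : [set _ | _] = set0); first exact: open0.
  by apply/seteqP; split=> y //= Py; apply: noP; exists y.
have [m [[x Px xm] minm]] := ord_wf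
  (P := [set v | exists2 x : a, P (val x) & val x = v])
  ltac:(by exists (val x0); exists x0).
have minx (y : Ord) : P y -> val x <= y.
  move=> Py; have [ya|ay] := ltP y a; last exact: le_trans (ltW (valP x)) ay.
  by rewrite xm; apply: minm; exists (exist _ y ya).
have nlim : ~ limit_ord (val x).
  move=> xlim; have [y yx /minx] := Plim _ (valP x) xlim Px.
  by rewrite leNgt yx.
have [[y [yx ysucc]]|nex] := pselect (exists y,
    y < val x /\ forall z, y < z -> val x <= z).
  pose y' : a := exist _ y (lt_trans yx (valP x)).
  rewrite (_ : [set _ | _] = [set` `]y', +oo[]); first exact: rray_open.
  apply/seteqP; split=> z /=; rewrite in_itv /= andbT => h.
    exact: lt_le_trans yx (minx _ h).
  have := ysucc _ h; rewrite le_eqVlt => /orP[/eqP <- //|xz].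
  exact: Pup xz Px.
rewrite (_ : [set _ | _] = setT); first exact: openT.
apply/seteqP; split=> z //= _.
suff : val x <= val z by rewrite le_eqVlt => /orP[/eqP <- //|/Pup]; apply.
rewrite leNgt; apply/negP => zx; apply: nlim; split; first by exists (val z).
move=> y yx; apply: contrapT => ny; apply: nex; exists y; split=> // t yt.
by rewrite leNgt; apply/negP => tx; apply: ny; exists t.
Qed.

Lemma homeomorphic_copy (a l : Ord) (S : set Ord) (f : Ord -> Ord) :
  ordinal_copy [set x | x < a] S f -> (forall x, x < a -> f x < l) ->
  homeomorphic a [set y : l | exists2 x, x < a & f x = val y].
Proof.
move=> [_ mono cont] fl; set X := [set y : l | _].
have inX (x : a) : (exist (fun z => z < l) _ (fl _ (valP x)) : l) \in X.
  by apply/mem_set; exists (val x) => //; exact: valP x.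
pose F (x : a) : X := exist (fun y => y \in X) _ (inX x).
have /choice[G GP] : forall y : X, exists x : a, f (val x) = val (val y).
  by move=> [y /= yX]; have [x xa fx] := set_mem yX; exists (exist _ x xa).
have monoP (x y : a) : (f (val x) < f (val y)) = (x < y).
  have [xy|yx|->] := ltgtP x y; last by rewrite ltxx.
    by apply: mono => //; exact: valP y.
  by apply/negbTE; rewrite -leNgt; apply/ltW/mono => //; exact: valP x.
have finj (x y : a) : f (val x) = f (val y) -> x = y.
  by move=> fxy; have := monoP x y; have := monoP y x;
    rewrite fxy ltxx; case: ltgtP.
have FK : cancel F G by move=> x; apply: finj; rewrite GP.
have GK : cancel G F.
  by move=> y; apply: val_inj; apply: val_inj; rewrite /= GP.
exists F, G; split=> //.
- apply/continuousP => _ [U oU <-].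
  suff cF : continuous ((fun x => val (F x)) : a -> l).
    by move/continuousP: cF; apply.
  apply: continuous_rays => b.
    rewrite (_ : [set _ | _] =
        [set x : a | [set x | x < a /\ f x < val b] (val x)]).
      apply: open_below => x y xy /= [ya fyb].
      by split; [apply: lt_trans xy ya|apply: lt_trans (mono _ _ xy ya) fyb].
    by apply/seteqP; split=> x //= => [xb|[]//]; split=> //; apply: valP x.
  (* The implication makes the predicate hold from [a] on, hence upward closed among all ordinals.
     Continuity at limits enters here. *)
  rewrite (_ : [set _ | _] =
      [set x : a | [set x | x < a -> val b < f x] (val x)]).
    apply: open_above => [x y xy /= Px ya|x xa xlim /= /(_ xa) bfx].
      exact: lt_trans (Px (lt_trans xy ya)) (mono _ _ xy ya).
    by have [y yx by_] := cont x xa xlim _ bfx; exists y.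
  by apply/seteqP; split=> x //=; apply; apply: valP x.
- apply: continuous_rays => b.
    exists [set` `]-oo, val (F b)[]; first exact: lray_open.
    apply/seteqP; split=> y /=; rewrite in_itv /= -monoP GP //.
  exists [set` `]val (F b), +oo[]; first exact: rray_open.
  by apply/seteqP; split=> y /=; rewrite in_itv /= andbT -monoP GP.
Qed.

(** * Unboundedness and enumeration of closure points *)

Lemma least_strict_bound (I : Type) (u : I -> Ord) (b : Ord) :
  (forall i, u i < b) -> exists s, [/\ s <= b, forall i, u i < s &
    forall z, z < s -> exists i, z <= u i].
Proof.
move=> ub; have [s [us mins]] := ord_wf (ex_intro [set s | forall i, u i < s] b ub).
exists s; split=> // [|z zs]; first exact: mins.
apply: contrapT => nz; move: zs; rewrite ltNge => /negP; apply; apply: mins => i.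
by rewrite ltNge; apply/negP => zi; apply: nz; exists i.
Qed.

(** Iterate omega times a map that jumps above [x] and above all values of [h] below [x]. The
    supremum is closed under [h], and the iterates are cofinal in it. *)
Lemma closure_point_above (M : Type) (l : Ord) (h : Ord -> Ord) :
  injects nat M -> bounds_families M l ->
  (forall x : Ord, x < l -> injects x M) ->
  (forall x, x < l -> h x < l) ->
  forall g, g < l -> exists2 d, d < l & g < d /\ closure_point h d.
Proof.
move=> natM bnd segM hl g gl.
have /choice[nx nxP] : forall x : Ord, exists y, x < l ->
    [/\ y < l, x < y & forall z, z < x -> h z < y].
  move=> x; have [xl|nxl] := pselect (x < l); last by exists x.
  have [|b bl hb] := @bnd x (fun z => h (val z)) (segM _ xl).
    by move=> z; apply/hl/(lt_trans (valP z) xl).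
  (* Bounding a constant family yields a point of [l] above both [b] and [x]. *)
  have [|y yl /(_ 0%N)] := @bnd nat (fun=> Order.max b x) natM.
    by move=> _; rewrite gt_max bl xl.
  rewrite gt_max => /andP[by_ xy]; exists y => _; split=> // z zx.
  exact: lt_trans (hb (exist _ z zx)) by_.
pose t := fix t n := if n is m.+1 then nx (t m) else g.
have tl n : t n < l by elim: n => [|n IH] //=; have [] := nxP _ IH.
have tS n : t n < t n.+1 by have [] := nxP _ (tl n).
have [b bl tb] := bnd nat t natM tl.
have [d [db td dt]] := least_strict_bound tb.
exists d; first exact: le_lt_trans db bl.
split; first exact: td 0%N.
split=> [x /dt[n xn]|].
  (* [nx] bounds [h] only strictly below its argument, hence two steps from [x <= t n] to
     [h x < t n.+2]. *)
  have [_ _ hz] := nxP _ (tl n.+1).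
  exact: lt_trans (hz _ (le_lt_trans xn (tS n))) (td n.+2).
exists t; split=> // z /dt[n zn]; exists n.+1.
exact: le_lt_trans zn (tS n).
Qed.

(** Recursion picks the least closure point above all earlier values. At a countable limit their
    supremum is again a closure point, hence is the value chosen. *)
Lemma closure_points_copy (M : Type) (l : Ord) (h : Ord -> Ord) :
  injects nat M -> bounds_families M l ->
  (forall x : Ord, x < l -> injects x M) ->
  (forall x, x < l -> h x < l) ->
  exists f, ordinal_copy [set x | x < omega1]
    [set d | d < l /\ closure_point h d] f.
Proof.
move=> natM bnd segM hl; pose E := [set d | d < l /\ closure_point h d].
(* Below [omega1] a suitable point exists, so the default [l] is not returned there. *)
pose step (x : Ord) (rec : forall y, y < x -> Ord) : Ord :=
  xget l [set d | [/\ E d, forall y yx, rec y yx < d &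
    forall d', E d' -> (forall y yx, rec y yx < d') -> d <= d']].
pose f := Fix lt_ord_wf (fun=> Ord) step.
have fE x : f x = step x (fun y _ => f y).
  apply: (@Fix_eq _ _ lt_ord_wf (fun=> Ord) step) => {}x r r' rr'; congr step.
  by apply: functional_extensionality_dep => y; apply/funext => yx; apply: rr'.
have fP (x : Ord) : x < omega1 -> [/\ E (f x), forall y, y < x -> f y < f x &
    forall d, E d -> (forall y, y < x -> f y < d) -> f x <= d].
  elim/(well_founded_ind lt_ord_wf): x => x IH xw.
  suff [d dP] : exists d, [/\ E d, forall y, y < x -> f y < d &
      forall d', E d' -> (forall y, y < x -> f y < d') -> d <= d'].
    by rewrite fE /step; case: xgetP => [d' _ //|/(_ d)[]].
  have [|b bl fb] := @bnd x (fun y => f (val y))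
      (injects_trans (lt_omega1 xw) natM).
    by move=> y; have [[]] := IH _ (valP y) (lt_trans (valP y) xw).
  have [d dl [bd hd]] := closure_point_above natM bnd segM hl bl.
  have [|d' [[Ed' fd'] mind']] :=
      ord_wf (P := [set d | E d /\ forall y, y < x -> f y < d]).
    exists d; split=> // y yx.
    exact: lt_trans (fb (exist _ y yx)) bd.
  by exists d'; split=> // d2 Ed2 fd2; apply: mind'.
exists f; split=> [x /fP[] //|x y xy /fP[_ + _]|x xw xlim z zfx]; first exact.
have [Efx f_lt f_min] := fP x xw.
have [s [sx fs sf]] := @least_strict_bound x (fun y => f (val y)) (f x)
  (fun y => f_lt _ (valP y)).
have {}fs y (yx : y < x) : f y < s := fs (exist _ y yx).
have {}sf w : w < s -> exists2 y, y < x & w < f y.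
  move=> /sf[[y yx] /= wy]; have [y' yy' y'x] := xlim.2 _ yx.
  have [_ f_lt' _] := fP y' (lt_trans y'x xw).
  by exists y' => //; apply: le_lt_trans wy (f_lt' _ yy').
suff Es : E s by apply: sf; apply: lt_le_trans zfx (f_min _ Es fs).
split; first exact: le_lt_trans sx Efx.1.
split=> [w /sf[y yx wy]|].
  have [[_ [hy _]] _ _] := fP y (lt_trans yx xw).
  exact: lt_trans (hy _ wy) (fs _ yx).
have [e eP] := countable_enum (lt_omega1 xw); have [x0 x0x] := xlim.1.
(* Enumerating the countable [x] gives a sequence cofinal in [s]; terms of [e] outside [x] are
   replaced by [x0]. *)
exists (fun n => if e n < x then f (e n) else f x0); split=> [n|w /sf[y yx wy]].
  by case: ifP => [enx|_]; apply: fs.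
by have [n en] := eP _ yx; exists n; rewrite en yx.
Qed.

(** * The arrow relation at and below the maximum *)

Lemma homeomorphic_injects (S T : topologicalType) :
  homeomorphic S T -> injects S T.
Proof. by move=> [f [g [fK _ _ _]]]; exists f; apply: can_inj fK. Qed.

Lemma ordn_lt m n : (m < n)%N -> ordn m < ordn n.
Proof.
move=> mn; rewrite lt_neqAle wseg_le; last exact: ltnW.
by rewrite andbT; apply/eqP => /wseg_inj E; rewrite E ltnn in mn.
Qed.

Lemma two_points (a : Ord) : ordn 2 <= a -> exists x y : a, x <> y.
Proof.
move=> a2; have a1 : ordn 1 < a by apply: lt_le_trans a2; apply: ordn_lt.
have a0 : ordn 0 < a by apply: lt_trans a1; apply: ordn_lt.
exists (exist (fun x => x < a) _ a0), (exist (fun x => x < a) _ a1).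
move=> /(f_equal val) /= E.
by have := @ordn_lt 0 1 isT; rewrite E ltxx.
Qed.

Lemma ordn_lt_omega1 n : ordn n < omega1.
Proof.
rewrite ltNge; apply/negP => /seg_injects h; apply: omega1_uncountable.
apply: injects_trans h (injects_trans (card_seg_rep _) _).
have /eq_otype[f [/wmono_inj fi _]] := ord_repK (ordn n).
have fi' : injects (wcar (ord_rep (ordn n)))
    (wcar (@wseg (Woset well_order_nat) n)).
  by exists f.
by apply: injects_trans fi' _; exists sval; apply: wmono_inj (wseg_initial _).1.
Qed.

Section Arrow.
Variables (kappa : Ord) (alpha : kappa -> Ord) (r : kappa).
Hypotheses (alpha_r : alpha r = omega1)
  (alpha_lt : forall i : kappa, i != r -> ordn 2 <= alpha i < omega1).

Let l : Ord := Order.max omega1 (card_succ kappa).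

Lemma alpha_ge2 i : ordn 2 <= alpha i.
Proof.
have [->|/alpha_lt/andP[]//] := eqVneq i r.
by rewrite alpha_r ltW // ordn_lt_omega1.
Qed.

Lemma no_small_arrow b : top_arrow alpha b -> l <= b.
Proof.
move=> arr; rewrite leNgt lt_max; apply/negP => /orP[bw|bk].
  have [i [X [Xi /homeomorphic_injects hX]]] := arr (fun=> r).
  have [x _] := two_points (alpha_ge2 i); have [f fi] := hX.
  (* [X] is nonempty because [alpha i] is, so its colour must be the constant [r]. *)
  have ir : i = r by have := Xi _ (set_mem (valP (f x))).
  apply: omega1_uncountable; rewrite -alpha_r -{1}ir; apply: injects_trans hX _.
  by apply: injects_trans (lt_omega1 bw); exists val; apply: val_inj.
have [c ci] := lt_card_succ bk.
have [i [X [Xi /homeomorphic_injects[f fi]]]] := arr c.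
have [x [y xy]] := two_points (alpha_ge2 i).
have Xc z : c (val (f z)) = i := Xi _ (set_mem (valP (f z))).
by apply: xy; apply: fi; apply: val_inj; apply: ci; rewrite !Xc.
Qed.

Lemma max_arrow : top_arrow alpha l.
Proof.
move=> c; have [M [natM kM sqM lM nlM]] := small_type kappa.
have bnd : bounds_families M l := bounds_families_not_injects natM sqM lM nlM.
pose S i : set Ord := [set x | exists2 y : l, val y = x & c y = i].
have Sl i x : S i x -> x < l by move=> [y <- _]; apply: (valP y).
have copy i f : ordinal_copy [set x | x < alpha i] (S i) f ->
    exists X : set l, X `<=` c @^-1` [set i] /\ homeomorphic (alpha i) X.
  move=> fP; have [fS _ _] := fP; eexists; split; last first.
    by apply: homeomorphic_copy fP _ => x /fS /Sl.
  move=> y [x xa fxy]; have [y' yy' <-] := fS x xa.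
  by rewrite (_ : y = y') //; apply: val_inj; rewrite yy' fxy.
have wl : omega1 <= l by rewrite le_max lexx.
have [[i ir Si]|nst] := pselect (exists2 i, i != r & stationary l (S i)).
  have /andP[_ aw] := alpha_lt ir.
  (* The lower bound [g] is taken to be [alpha i], which lies below [l]. The copy of the closed
     segment is then restricted to [alpha i]. *)
  have [f [fS f_mono f_cont]] :=
    stationary_copy natM bnd (Sl i) Si aw (lt_le_trans aw wl).
  exists i; apply: (copy i f); split=> [x xa|x y xy ya|x xa].
  - by have [] := fS x (ltW xa).
  - exact: f_mono xy (ltW ya).
  - exact: f_cont (ltW xa).
(* Non-stationarity gives a function whose closure points avoid colour [i]; [id] fills the place of
   [r]. *)
have /choice[h hP] : forall i, exists h : Ord -> Ord,
    (forall x, x < l -> h x < l) /\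
    (i != r -> forall d, d < l -> closure_point h d -> ~ S i d).
  move=> i; have [->|ir] := eqVneq i r; first by exists id.
  apply: contrapT => nh; apply: nst; exists i => // h hl.
  apply: contrapT => nd; apply: nh; exists h; split=> // _ d dl hd Sd.
  by apply: nd; exists d.
(* As [kappa] injects into [M], the [h i] have a common pointwise bound; its closure points are
   closure points of every [h i]. *)
have /choice[H HP] : forall x, exists y, x < l -> y < l /\ forall i, h i x < y.
  move=> x; have [xl|nxl] := pselect (x < l); last by exists x.
  have [|y yl hy] := bnd kappa (fun i => h i x) kM; last by exists y.
  by move=> i; apply: (hP i).1.
have [f [fS f_mono f_cont]] := closure_points_copy natM bnd lM
  (fun x xl => (HP x xl).1).
exists r; apply: (copy r f); rewrite alpha_r; split=> // x /fS[dl [Hd cof]].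
exists (exist (fun y => y < l) _ dl) => //; apply: contrapT => cr.
have ir : c (exist (fun y => y < l) _ dl) != r by apply/eqP.
apply: ((hP _).2 ir _ dl); last by exists (exist (fun y => y < l) _ dl).
split=> // y yd; apply: lt_trans (Hd _ yd).
exact: (HP _ (lt_trans yd dl)).2.
Qed.

End Arrow.

Theorem theorem4p20 (kappa : Ord) (kappa_card : is_cardinal kappa)
    (alpha : kappa -> Ord) (r : kappa) (alpha_r : alpha r = omega1)
    (alpha_lt : forall i : kappa, i != r -> ordn 2 <= alpha i < omega1) :
  Ptop alpha = Some (Order.max omega1 (card_succ kappa)).
Proof.
have arr := max_arrow alpha_r alpha_lt.
rewrite /Ptop; case: pselect => [ex|[]]; last by eexists; exact: arr.
congr Some; rewrite /least; case: cid => b [/= arrb minb] /=.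
by apply/eqP; rewrite eq_le minb // (no_small_arrow alpha_r alpha_lt arrb).
Qed.
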